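(* Let $k\ge 1$ be an integer, let $(m_0,m_1,\dots)$ be a sequence of positive integers, let $K_j$ ($j<\omega$) be sets such that $|K_j|\ge j+1$, and let $$c:\bigcup_{n<\omega}\ \bigcup_{l\le n}\Big([K_l]^k\times \prod_{j\in (n+1)\setminus\{l\}}K_j\Big)\to 2$$ be a coloring. Then there are infinite sets $L,N\subseteq \omega$ such that, enumerating $L=\{l_0<l_1<\dots\}$ and $N=\{n_0<n_1<\dots\}$ in increasing order, $l_0\le n_0<l_1\le n_1<\dots$, and there are subsets $H_j\subseteq K_j$ ($j<\omega$) such that $|H_{l_i}|=m_i$ for each $i<\omega$, $|H_j|=1$ for each $j\in\omega\setminus L$, and $c$ is constant on $$\bigcup_{n\in N}\ \bigcup_{l\in L\cap (n+1)}\Big([H_l]^k\times\prod_{j\in (n+1)\setminus\{l\}}H_j\Big).$$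
   Context: Conventions: $\omega=\{0,1,2,\dots\}$; each natural number $n$ is identified with $\{0,\dots,n-1\}$, so $n+1=\{0,\dots,n\}$ and $2=\{0,1\}$. For a set $K$, $[K]^k$ is the set of all subsets of $K$ of cardinality exactly $k$. For $l\le n$, the notation $[K_l]^k\times \prod_{j\in (n+1)\setminus\{l\}}K_j$ denotes the ordered product $K_0\times\dots\times K_{l-1}\times [K_l]^k\times K_{l+1}\times\dots\times K_n$ (the $k$-element subset sits in coordinate $l$), and similarly with $H$ in place of $K$. The unions in the domain of $c$ are over formally distinct products, i.e. an element of the domain carries the data of $n$, of $l$, and of the tuple. *)

(* Defs.v *)
From mathcomp Require Import all_boot.
From mathcomp Require Import boolp classical_sets functions cardinality.
Set Implicit Arguments.
Unset Strict Implicit.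
Unset Printing Implicit Defensive.
Local Open Scope classical_set_scope.
Local Open Scope card_scope.

(* [H]^k *)
Definition ksubsets (T : Type) (k : nat) (H : set T) : set (set T) :=
  [set A | A `<=` H /\ A #= `I_k].

(* The disjoint union over n and l <= n of [K_l]^k x \prod_(j <= n, j != l) K_j.
   Both proof components, [pt_setP] and the argument j != pt_l of [pt_tuple],
   are irrelevant. *)
Record prod_point (k : nat) (K : nat -> Type) := ProdPoint {
  pt_n : nat;
  pt_l : 'I_pt_n.+1;
  pt_set : set (K pt_l);
  pt_setP : ksubsets k [set: K pt_l] pt_set;
  pt_tuple : forall j : 'I_pt_n.+1, j != pt_l -> K j
}.
Arguments pt_set {k K} p _.
Arguments pt_tuple {k K} p j _.

(* [H_l]^k x \prod_(j <= n, j != l) H_j, as a part of the disjoint union;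
   it is empty unless l <= n. *)
Definition box (k : nat) (K : nat -> Type) (H : forall j, set (K j))
    (n l : nat) : set (prod_point k K) :=
  [set p | [/\ pt_n p = n, pt_l p = l :> nat,
               ksubsets k (H (pt_l p)) (pt_set p) &
               forall (j : 'I_(pt_n p).+1) (jl : j != pt_l p),
                 H j (pt_tuple p j jl)]].

Definition increasing_enum (A : set nat) (a : nat -> nat) : Prop :=
  {homo a : i j / (i < j)%N} /\ range a = A.

Definition constant_on (T U : Type) (f : T -> U) (D : set T) : Prop :=
  exists b : U, forall x, D x -> f x = b.

(* Main.v *)
(* Fix injections of {0,...,j} into K_j, so that a point is a sequence of
   natural numbers, and let x be a random point with independent uniform
   coordinates x_j in a finite set.

   If infinitely many events D_n, each depending on
   finitely many coordinates, have probability at least delta, then one can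
   commit to finitely many coordinates so that one D_n0 holds outright while
   infinitely many D_n keep probability at least some delta' > 0 depending on
   delta only.  Moreover a coordinate l whose range is large compared with
   1/delta has, with probability delta/2, a large section in D_n, inside which
   finite combinatorics (Ramsey's theorem) may be applied.

   First round.  Alternating the two operations gives l_0 <= n_0 < l_1 <= ...
   and sets H_j, of size i+1 at l_i and singletons elsewhere, such that for
   j <= i the colour of a point of level n_i with its k-set at l_j is v_j(x),
   which depends on the coordinates of x below l_j only: when l_j is treated,
   Ramsey's theorem removes the dependence on the k-set, and passing to sections
   in D_n keeps the earlier colours independent of the new coordinate.

   Second round.  On the product of the H_j, for some colour b infinitely many of
   the events v_j = b have probability at least 1/2.  The same alternation then
   selects infinitely many j and subsets of the H_l of the prescribed sizes on
   which v_j = b. *)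
Require Import Defs.
From mathcomp Require Import all_boot all_order all_algebra.
From mathcomp Require Import boolp classical_sets functions cardinality.
Set Implicit Arguments.
Unset Strict Implicit.
Unset Printing Implicit Defensive.
Import Order.TTheory GRing.Theory Num.Theory.
Local Open Scope classical_set_scope.
Local Open Scope card_scope.

(** * Sequences and Ramsey's theorem *)

Lemma dependent_choice_seq (S : Type) (Inv : nat -> S -> Prop)
    (R : nat -> S -> S -> Prop) (s0 : S) :
  Inv 0 s0 ->
  (forall i s, Inv i s -> exists s', Inv i.+1 s' /\ R i s s') ->
  exists f : nat -> S, f 0 = s0 /\ forall i, Inv i (f i) /\ R i (f i) (f i.+1).
Proof.
move=> I0 IR.
have /choice[g gP] : forall u : nat * S, exists s', Inv u.1 u.2 ->
    Inv u.1.+1 s' /\ R u.1 u.2 s'.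
  move=> [i s] /=; have [/IR[s' ?]|Is] := EM (Inv i s); first by exists s'.
  by exists s.
pose f := fix f i := if i is i'.+1 then g (i', f i') else s0.
have If i : Inv i (f i) by elim: i => //= i Ii; have [] := gP (i, f i) Ii.
by exists f; split=> // i; split=> //; have [] := gP (i, f i) (If i).
Qed.

(** Stage [i] freezes the values below [a i]. Strict growth gives [p < a p.+1], so the diagonal
    [G p.+1 p] already shows the final value at [p]. *)
Lemma limit_of_agreeing (T : Type) (a : nat -> nat) (G : nat -> nat -> T) :
  (forall i, a i < a i.+1) ->
  (forall i p, p < a i -> G i.+1 p = G i p) ->
  forall i p, p < a i -> G p.+1 p = G i p.
Proof.
move=> aS GS.
have aP i : i <= a i by elim: i => // i Hi; apply: leq_ltn_trans Hi (aS i).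
have amono i j : i <= j -> a i <= a j.
  move=> /subnK <-; elim: (j - i) => // d IH.
  by rewrite addSn; apply: leq_trans IH (ltnW (aS _)).
have Gij i j p : i <= j -> p < a i -> G j p = G i p.
  move=> /subnK <- pi; elim: (j - i) => // d IH; rewrite addSn GS //.
  by apply: leq_trans pi (amono _ _ _); rewrite leq_addl.
move=> i p pi; have [le|lt] := leqP i p.+1; first exact: Gij.
by symmetry; apply: Gij => //; exact: ltnW.
Qed.

Definition freq (P : nat -> Prop) := forall m, exists2 n, m <= n & P n.

Lemma freq_sub (P Q : nat -> Prop) m :
  freq P -> (forall n, m <= n -> P n -> Q n) -> freq Q.
Proof.
move=> fP PQ m'; have [n] := fP (maxn m m').
by rewrite geq_max => /andP[mn m'n] Pn; exists n => //; apply: PQ.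
Qed.

Lemma freq_or (P Q : nat -> Prop) :
  freq (fun n => P n \/ Q n) -> freq P \/ freq Q.
Proof.
move=> f; apply: contrapT => /not_orP[/existsNP[m1 nP] /existsNP[m2 nQ]].
have [n] := f (maxn m1 m2); rewrite geq_max => /andP[n1 n2] [Pn|Qn].
- by apply: nP; exists n.
- by apply: nQ; exists n.
Qed.

Lemma freq_pigeonhole (T : eqType) (s : seq T) (P : T -> nat -> Prop) :
  freq (fun n => exists2 t, t \in s & P t n) -> exists2 t, t \in s & freq (P t).
Proof.
elim: s => [|t s IH] fP; first by have [n _ []] := fP 0.
case: (@freq_or (P t) (fun n => exists2 t, t \in s & P t n)).
- apply: (freq_sub (m := 0) fP) => n _ [t']; rewrite inE => /orP[/eqP ->|ts] H.
    by left.
  by right; exists t'.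
- by exists t => //; rewrite mem_head.
- by move=> /IH[t' ts H]; exists t' => //; rewrite inE ts orbT.
Qed.

Definition homogeneous (T : eqType) (C : Type) (k : nat) (f : seq T -> C)
  (t : seq T) (v : C) := forall u, subseq u t -> size u = k -> f u = v.

(** The Erdos-Rado notion: the value of [f] on a subsequence of length [k.+1] depends only on its
    first element, and [g] lists this value for each element of [t]. *)
Fixpoint end_homogeneous (T : eqType) (C : Type) (k : nat) (f : seq T -> C)
  (t : seq T) (g : seq C) : Prop :=
  match t, g with
  | x :: t', v :: g' => homogeneous k (f \o cons x) t' v /\
                        end_homogeneous k f t' g'
  | [::], [::] => True
  | _, _ => False
  end.

(** The entries of [t] labelled [v] form [u]: any [k.+1] of them have the colour announced by the
    first one, which is [v]. *)
Lemma end_homogeneous_monochromatic (T C : eqType) k (f : seq T -> C) t g v :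
  end_homogeneous k f t g ->
  exists u, [/\ subseq u t, size u = count_mem v g & homogeneous k.+1 f u v].
Proof.
elim: t g => [|x t IH] [|w g] //=.
  by move=> _; exists [::]; split=> // u; rewrite subseq0 => /eqP ->.
move=> [hx /IH[u [ut su hu]]]; have [ewv|_] := eqVneq w v.
  exists (x :: u); split=> /=; rewrite ?eqxx ?su // -ewv => -[|y s] //=.
  case: eqP => [-> sub|_ sub] ss; last by rewrite ewv; exact: hu.
  by case: ss => ss; apply: (hx s) => //; exact: subseq_trans ut.
exists u; split=> //; first exact: subseq_trans (subseq_cons _ _).
Qed.

Lemma homogeneous_sub (T C : eqType) k (f : seq T -> C) t u v :
  subseq u t -> homogeneous k f t v -> homogeneous k f u v.
Proof. by move=> ut h w wu; apply: h; apply: subseq_trans ut. Qed.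

(** Peeling off one element [x] and applying Ramsey's theorem for [k] to [f \o cons x] on the rest
    leaves a long sequence on which the construction repeats. *)
Lemma end_homogeneous_exists (T C : eqType) k :
  (forall M, exists R, forall (f : seq T -> C) s, R <= size s ->
     exists t v, [/\ subseq t s, size t = M & homogeneous k f t v]) ->
  forall p, exists R, forall (f : seq T -> C) s, R <= size s ->
    exists t g, [/\ subseq t s, size g = p & end_homogeneous k f t g].
Proof.
move=> ramk; elim=> [|p [R1 H1]].
  by exists 0 => f s _; exists [::], [::]; split=> //; exact: sub0seq.
have [R H] := ramk R1; exists R.+1 => f [|x s] //= Rs.
have [s1 [v [s1s ss1 hv]]] := H (f \o cons x) s Rs.
have [|t [g [ts sg ht]]] := H1 f s1; first by rewrite ss1.
exists (x :: t), (v :: g); split=> /=; rewrite ?eqxx ?sg //.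
  exact: subseq_trans s1s.
by split=> //; exact: homogeneous_sub hv.
Qed.

Lemma count_pigeonhole (C : finType) (g : seq C) M :
  #|C| * M < size g -> exists v, M < count_mem v g.
Proof.
move=> lt; apply: contrapT => /forallNP H.
suff: size g <= #|C| * M by rewrite leqNgt lt.
have -> : size g = \sum_(v : C) count_mem v g.
  elim: g {lt H} => [|w g IH] /=; first by rewrite big1.
  rewrite big_split /= -IH (bigD1 w) //= eqxx big1 ?addn0 // => v.
  by rewrite eq_sym => /negPf ->.
rewrite -sum_nat_const; apply: leq_sum => v _; rewrite leqNgt.
by apply/negP; exact: H.
Qed.

Lemma finite_ramsey (T : eqType) (C : finType) k M :
  exists R, forall (f : seq T -> C) s, R <= size s ->
    exists t v, [/\ subseq t s, size t = M & homogeneous k f t v].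
Proof.
elim: k M => [|k IH] M.
  exists M => f s Ms; exists (take M s), (f [::]); split.
  - exact: take_subseq.
  - by rewrite size_takel.
  - by move=> u _ /size0nil ->.
have [R H] := end_homogeneous_exists IH (#|C| * M).+1.
exists R => f s Rs; have [t [g [ts sg ht]]] := H f s Rs.
have [|v Mv] := @count_pigeonhole C g M; first by rewrite sg.
have [u [ut su hu]] := end_homogeneous_monochromatic v ht.
exists (take M u), v; split.
- by apply: subseq_trans (take_subseq _ _) _; exact: subseq_trans ts.
- by rewrite size_takel // su ltnW.
- by apply: homogeneous_sub hu; exact: take_subseq.
Qed.

(** * Density *)

Definition npoint := nat -> nat.

Definition upd (x : npoint) (j e : nat) : npoint :=
  fun p => if p == j then e else x p.

Lemma updC x i j e e' : i != j ->
  upd (upd x i e) j e' = upd (upd x j e') i e.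
Proof.
by move=> ij; apply/funext => p; rewrite /upd; case: (p =P j) => [->|//];
  rewrite eq_sym (negPf ij).
Qed.

Lemma upd_upd x j e e' : upd (upd x j e) j e' = upd x j e'.
Proof. by apply/funext => p; rewrite /upd; case: eqP. Qed.

Definition depends_below (U : Type) (d : nat) (f : npoint -> U) :=
  forall x y, (forall p, p < d -> x p = y p) -> f x = f y.

Section Density.
Local Open Scope ring_scope.
Variable K : nat -> seq nat.
Hypothesis K0 : forall j, (0 < size (K j))%N.

Definition ind (P : Prop) : rat := `[< P >]%:R.

Lemma ind_ge0 P : 0 <= ind P. Proof. exact: ler0n. Qed.
Lemma ind_le1 P : ind P <= 1. Proof. by rewrite /ind lern1 leq_b1. Qed.
Lemma ind1 (P : Prop) : P -> ind P = 1.
Proof. by move=> p; rewrite /ind asboolT. Qed.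
Lemma ind0 (P : Prop) : ~ P -> ind P = 0.
Proof. by move=> p; rewrite /ind asboolF. Qed.
Lemma ind_le (P Q : Prop) : (P -> Q) -> ind P <= ind Q.
Proof.
by move=> PQ; have [/[dup] p /PQ q|p] := EM P;
  rewrite ?(ind1 p) ?(ind1 q) // (ind0 p) ind_ge0.
Qed.

Definition avg (j : nat) (f : npoint -> rat) : npoint -> rat :=
  fun x => (\sum_(e <- K j) f (upd x j e)) / (size (K j))%:R.

(* The expectation over the coordinates in [s], each uniform in its [K j], the
   other coordinates being those of the argument. *)
Definition expect (s : seq nat) (f : npoint -> rat) := foldr avg f s.

Lemma sizeK_gt0 j : 0 < (size (K j))%:R :> rat.
Proof. by rewrite ltr0n. Qed.

(** [y] and [z] share their random coordinates. Allowing two base points permits comparisons across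
    a change of the coordinates outside [s]. *)
Lemma expect_le s f g x x' :
  (forall y z, (forall p, p \in s -> y p = z p) ->
     (forall p, p \notin s -> y p = x p) ->
     (forall p, p \notin s -> z p = x' p) -> f y <= g z) ->
  expect s f x <= expect s g x'.
Proof.
elim: s x x' => [|j s IH] x x' fg /=; first exact: fg.
rewrite ler_pM2r ?invr_gt0 ?sizeK_gt0 //; apply: ler_sum => e _.
apply: IH => y z yz yx zx; apply: fg => p; last first.
- by rewrite inE negb_or => /andP[pj ps]; rewrite zx // /upd (negPf pj).
- by rewrite inE negb_or => /andP[pj ps]; rewrite yx // /upd (negPf pj).
- have [ps|ps] := boolP (p \in s); first by rewrite yz.
  by rewrite inE (negPf ps) orbF => pj; rewrite yx ?zx // /upd pj.
Qed.

Lemma expect_le_at s f g x :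
  (forall y, (forall p, p \notin s -> y p = x p) -> f y <= g y) ->
  expect s f x <= expect s g x.
Proof.
move=> fg; apply: expect_le => y z yz yx zx.
have -> : y = z; last exact: fg.
by apply/funext => p; have [/yz//|ps] := boolP (p \in s); rewrite yx ?zx.
Qed.

Lemma expect_cat s t f : expect (s ++ t) f = expect s (expect t f).
Proof. by rewrite /expect foldr_cat. Qed.

Lemma expect_sum (I : Type) (r : seq I) (F : I -> npoint -> rat) s x :
  expect s (fun y => \sum_(i <- r) F i y) x = \sum_(i <- r) expect s (F i) x.
Proof.
elim: s x => //= j s IH x; rewrite /avg (eq_bigr _ (fun e _ => IH _)).
by rewrite exchange_big /= mulr_suml.
Qed.

Lemma expectD s f g x :
  expect s (fun y => f y + g y) x = expect s f x + expect s g x.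
Proof.
elim: s x => //= j s IH x; rewrite /avg (eq_bigr _ (fun e _ => IH _)).
by rewrite big_split /= mulrDl.
Qed.

Lemma expect_cst s c x : expect s (fun=> c) x = c.
Proof.
elim: s x => //= j s IH x; rewrite /avg (eq_bigr _ (fun e _ => IH _)).
rewrite big_const_seq count_predT iter_addr_0 -[c *+ _]mulr_natr mulfK //.
by rewrite gt_eqF // sizeK_gt0.
Qed.

Lemma expect_fixed s f x :
  (forall y, (forall p, p \notin s -> y p = x p) -> f y = f x) ->
  expect s f x = f x.
Proof.
move=> fx; rewrite -[RHS](expect_cst s (f x) x); apply/le_anti/andP.
by split; apply: expect_le => y z _ yx zx; rewrite fx.
Qed.

Lemma expect_ind_le1 s P x : expect s (fun y => ind (P y)) x <= 1.
Proof.
rewrite -[leRHS](expect_cst s _ x); apply: expect_le_at => y _.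
exact: ind_le1.
Qed.

Lemma expect_avgC s j f x : j \notin s ->
  expect s (avg j f) x = avg j (expect s f) x.
Proof.
elim: s x => //= i s IH x; rewrite inE negb_or => /andP[ji js].
rewrite {1}/avg (eq_bigr _ (fun e _ => IH _ js)) /avg !mulr_suml.
under eq_bigr do rewrite !mulr_suml.
under [RHS]eq_bigr do rewrite !mulr_suml.
rewrite exchange_big /=; apply: eq_bigr => e _; apply: eq_bigr => e' _.
by rewrite updC 1?eq_sym // mulrAC.
Qed.

Lemma expect_avg s j f x : uniq s -> j \in s ->
  expect s (avg j f) x = expect s f x.
Proof.
elim: s x => //= i s IH x /andP[is_ us].
have [-> _|ji] := eqVneq j i; last first.
  by rewrite inE (negPf ji) /= => js; congr (avg i _ x); apply/funext => y; exact: IH.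
rewrite {1}/avg (eq_bigr _ (fun e _ => expect_avgC _ _ is_)).
rewrite /avg; under eq_bigr do under eq_bigr do rewrite upd_upd.
by rewrite big_const_seq count_predT iter_addr_0 -[X in X / _]mulr_natr mulfK //
  gt_eqF // sizeK_gt0.
Qed.

(** Averaging over coordinate [l] first replaces [D] by the proportion of its section, which is at
    most 1 when the section is large and at most [delta / 2] otherwise. *)
Lemma expect_big_section s l M (D : npoint -> Prop) (delta : rat) x :
  0 < delta -> uniq s -> l \in s -> M%:R <= (size (K l))%:R * (delta / 2) ->
  delta <= expect s (fun y => ind (D y)) x ->
  delta / 2 <=
    expect s (fun y => ind (M <= count (fun e => `[< D (upd y l e) >]) (K l))%N) x.
Proof.
move=> d0 us ls Ml; rewrite -(expect_avg _ _ us ls) => dE.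
rewrite -(lerD2r (delta / 2)) -splitr; apply: le_trans dE _.
rewrite -[X in _ <= _ + X](expect_cst s _ x) -expectD.
have S0 := sizeK_gt0 l.
apply: expect_le_at => z _.
rewrite /avg ler_pdivrMr //.
have -> : \sum_(e <- K l) ind (D (upd z l e)) =
    (count (fun e => `[< D (upd z l e) >]) (K l))%:R :> rat.
  by rewrite -sum1_count natr_sum [RHS]big_mkcond; apply: eq_bigr => e _;
    rewrite /ind; case: asbool.
have [big|small] := leqP M (count _ (K l)).
  rewrite ind1 // mulrDl mul1r ler_wpDr ?ler_nat ?count_size //.
  by rewrite mulr_ge0 // ltW // divr_gt0.
rewrite ind0 // add0r.
by rewrite mulrC; apply: le_trans Ml; rewrite ler_nat ltnW.
Qed.

(** A union bound; with [#|T|.+1] in the denominator the sum of too small probabilities stays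
    strictly below [delta], even for empty [T]. *)
Lemma expect_cover (T : finType) s (B : npoint -> Prop) (F : T -> npoint -> Prop)
    (delta : rat) x :
  0 < delta -> (forall y, B y -> exists t, F t y) ->
  delta <= expect s (fun y => ind (B y)) x ->
  exists t, delta / #|T|.+1%:R <= expect s (fun y => ind (F t y)) x.
Proof.
move=> d0 BF dB; apply: contrapT => /forallNP H.
have : delta <= \sum_(t : T) expect s (fun y => ind (F t y)) x.
  apply: le_trans dB _; rewrite -expect_sum; apply: expect_le_at => z _.
  have [/[dup] Bz /BF[t Ft]|nB] := EM (B z); last first.
    by rewrite ind0 //; apply: sumr_ge0 => t _; exact: ind_ge0.
  rewrite (bigD1 t) //= (ind1 Bz) (ind1 Ft) lerDl.
  by apply: sumr_ge0 => ? _; exact: ind_ge0.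
apply/negP; rewrite -ltNge.
apply: (@le_lt_trans _ _ (\sum_(t : T) delta / #|T|.+1%:R)).
  apply: ler_sum => t _; rewrite leNgt; apply/negP => lt; apply: (H t).
  exact: ltW.
rewrite sumr_const -[X in X < _]mulr_natr mulrAC ltr_pdivrMr ?ltr0n // ltr_pM2l //.
by rewrite ltr_nat.
Qed.

(** The finite type [T] does not vary with [n], so by pigeonhole one [t] serves infinitely many
    [n]. *)
Lemma freq_section (T : finType) (s : nat -> seq nat)
    (D : nat -> npoint -> Prop) (F : T -> nat -> npoint -> Prop) l M (delta : rat) x :
  0 < delta -> M%:R <= (size (K l))%:R * (delta / 2) ->
  (forall n y, (M <= count (fun e => `[< D n (upd y l e) >]) (K l))%N ->
     exists t, F t n y) ->
  freq (fun n => [/\ uniq (s n), l \in s n &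
                     delta <= expect (s n) (fun y => ind (D n y)) x]) ->
  exists t, freq (fun n => delta / 2 / #|T|.+1%:R
                             <= expect (s n) (fun y => ind (F t n y)) x).
Proof.
move=> d0 Ml DF fD; have [|t _ ft] := @freq_pigeonhole T (enum T) (fun t n =>
    delta / 2 / #|T|.+1%:R <= expect (s n) (fun y => ind (F t n y)) x);
  last by exists t.
apply: (freq_sub (m := 0) fD) => n _ [us ls dE].
have d20 : 0 < delta / 2 by rewrite divr_gt0.
have [t Ht] := expect_cover d20 (DF n) (expect_big_section d0 us ls Ml dE).
by exists t; rewrite ?mem_enum.
Qed.

(** Coordinate by coordinate, some value does at least as well as the average; as [K j] is finite,
    one value does so for infinitely many [n]. *)
Lemma freq_expect_point s (g : nat -> npoint -> rat) (delta : rat) x :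
  freq (fun n => delta <= expect s (g n) x) ->
  exists x', [/\ forall p, p \notin s -> x' p = x p,
                 forall p, p \in s -> x' p \in K p &
                 freq (fun n => delta <= g n x')].
Proof.
elim: s x => [|j s IH] x /= fE; first by exists x.
have [|e ej fe] := @freq_pigeonhole _ (K j) (fun e n =>
    delta <= expect s (g n) (upd x j e)).
  apply: (freq_sub (m := 0) fE) => n _; rewrite /avg ler_pdivlMr ?sizeK_gt0 // => dE.
  apply: contrapT => H; move: dE; apply/negP; rewrite -ltNge.
  rewrite mulr_natr -iter_addr_0 -count_predT -big_const_seq.
  rewrite big_seq [ltRHS]big_seq; apply: ltr_sum.
    by case: (K j) (K0 j) => //= e es _; rewrite inE eqxx.
  move=> e ej; rewrite ltNge; apply/negP => dE; apply: H; by exists e.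
have [x' [x'o x'i fx']] := IH _ fe; exists x'; split=> // p.
- by rewrite inE negb_or => /andP[pj ps]; rewrite x'o // /upd (negPf pj).
- have [ps _|ps] := boolP (p \in s); first exact: x'i.
  by rewrite inE (negPf ps) orbF => pj; rewrite x'o // /upd pj (eqP pj).
Qed.

Lemma index_iota_cat a b c : (a <= b <= c)%N ->
  index_iota a c = index_iota a b ++ index_iota b c.
Proof.
move=> /andP[ab bc]; rewrite /index_iota.
have -> : (c - a = (b - a) + (c - b))%N by rewrite addnC addnBA // subnK.
by rewrite iotaD subnKC.
Qed.

Lemma expect_extend a b c f x : (a <= b <= c)%N -> depends_below b f ->
  expect (index_iota a c) f x = expect (index_iota a b) f x.
Proof.
move=> abc fb; rewrite (index_iota_cat abc) expect_cat; congr (expect _ _ x).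
apply/funext => y; apply: expect_fixed => z zy; apply: fb => p pb; apply: zy.
by rewrite mem_index_iota negb_and -ltnNge pb.
Qed.

Section Levels.
Variables (d : nat -> nat) (D : nat -> npoint -> Prop).
Hypothesis d_homo : {homo d : i j / (i <= j)%N}.
Hypothesis d_ge : forall i, (i <= d i)%N.
Hypothesis D_dep : forall i, depends_below (d i) (D i).

(* If [r] members of a family of events of probability [>= delta] had pairwise
   intersections of probability less than [delta'], their union would have
   probability at least [r (delta - r delta')], which is impossible for
   [r > 2 / delta] and [delta' = delta / 2r]. *)
Lemma freq_pair a (delta : rat) x : 0 < delta ->
  freq (fun i => delta <= expect (index_iota a (d i)) (fun y => ind (D i y)) x) ->
  exists2 delta' : rat, 0 < delta' & forall m, exists2 i0, (m <= i0)%N &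
    freq (fun i => delta' <=
      expect (index_iota a (d i)) (fun y => ind (D i0 y /\ D i y)) x).
Proof.
move=> d0 fD; pose r := (Num.bound (2 / delta)).+1.
have r0 : 0 < r%:R :> rat by rewrite ltr0n.
have rd : 1 < r%:R * (delta / 2).
  have: 2 / delta < r%:R.
    apply: lt_trans (archi_boundP _) _; rewrite ?ltr_nat //.
    by rewrite divr_ge0 // ltW.
  by rewrite ltr_pdivrMr // mulrA ltr_pdivlMr // mul1r.
exists (delta / 2 / r%:R); first by rewrite !divr_gt0.
set delta' := delta / 2 / r%:R => m; apply: contrapT => nex.
have /choice[th thP] : forall i0, exists t, forall i, (m <= i0)%N -> (t <= i)%N ->
    expect (index_iota a (d i)) (fun y => ind (D i0 y /\ D i y)) x < delta'.
  move=> i0; apply: contrapT => /forallNP nt; apply: nex.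
  have mi0 : (m <= i0)%N.
    by rewrite leqNgt; apply/negP => lt; apply: (nt 0%N) => i; rewrite leqNgt lt.
  exists i0 => // t; apply: contrapT => ex; apply: (nt t) => i _ ti.
  by rewrite ltNge; apply/negP => le; apply: ex; exists i.
pose U (I : seq nat) y := exists2 i, i \in I & D i y.
have : forall t, (t <= r)%N -> exists (I : seq nat) (i1 : nat),
    [/\ size I = t, forall i, i \in I -> (m <= i <= i1)%N, (a <= i1)%N &
     t%:R * (delta / 2) <= expect (index_iota a (d i1)) (fun y => ind (U I y)) x].
  elim=> [|t IH] tr.
    exists [::], a; split=> //; rewrite mul0r.
    rewrite -[leLHS](expect_cst (index_iota a (d a)) 0 x).
    by apply: expect_le_at => y _; exact: ind_ge0.
  have [I [i1 [It Im ai1 EI]]] := IH (ltnW tr).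
  (* Beyond every threshold [th i], each overlap of [D j] with an earlier member is below [delta'];
     fewer than [r] overlaps cost at most [delta / 2] in all. *)
  have [j] := fD (maxn i1 (maxn m (\max_(i <- I) th i))).
  rewrite !geq_max => /and3P[i1j mj thj] EDj.
  exists (j :: I), j; split=> /=; rewrite ?It //; last first.
  - have Ud : depends_below (d i1) (fun y => ind (U I y)).
      move=> y z yz; rewrite /ind; congr (nat_of_bool `[< _ >])%:R.
      apply/propext; split=> -[i iI Di]; exists i => //.
        rewrite -(@D_dep i y) // => p pi; apply: yz; apply: leq_trans pi _.
        by apply: d_homo; case/andP: (Im _ iI).
      rewrite (@D_dep i y z) // => p pi; apply: yz; apply: leq_trans pi _.
      by apply: d_homo; case/andP: (Im _ iI).
    have {}EI : t%:R * (delta / 2) <=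
        expect (index_iota a (d j)) (fun y => ind (U I y)) x.
      rewrite (expect_extend _ _ Ud) // (leq_trans ai1 (d_ge _)) /=.
      exact: d_homo.
    have Einter : expect (index_iota a (d j))
        (fun y => \sum_(i <- I) ind (D i y /\ D j y)) x <= delta / 2.
      rewrite expect_sum; apply: (@le_trans _ _ (\sum_(i <- I) delta')).
        rewrite big_seq [leRHS]big_seq; apply: ler_sum => i iI; apply/ltW/thP.
          by case/andP: (Im _ iI).
        by apply: leq_trans thj; exact: leq_bigmax_seq.
      rewrite big_const_seq count_predT iter_addr_0 It -[leLHS]mulr_natr /delta'.
      rewrite mulrAC ler_pdivrMr // ler_pM2l ?ler_nat 1?ltnW //.
      exact: divr_gt0.
    have : expect (index_iota a (d j)) (fun y => ind (U I y) + ind (D j y)) x <=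
        expect (index_iota a (d j)) (fun y => ind (U (j :: I) y) +
            \sum_(i <- I) ind (D i y /\ D j y)) x.
      apply: expect_le_at => z _.
      have S0 : 0 <= \sum_(i <- I) ind (D i z /\ D j z).
        by apply: sumr_ge0 => ? _; exact: ind_ge0.
      have [Dj|nDj] := EM (D j z); last first.
        rewrite (ind0 nDj) addr0 ler_wpDr //; apply: ind_le => -[i iI Di].
        by exists i => //; rewrite inE iI orbT.
      have Uj : U (j :: I) z by exists j; rewrite ?inE ?eqxx.
      rewrite (ind1 Dj) (ind1 Uj) addrC lerD2l.
      have [[i iI Di]|nU] := EM (U I z); last by rewrite ind0.
      apply: le_trans (ind_le1 _) _; rewrite (big_rem i) //= ind1 // lerDl.
      by apply: sumr_ge0 => ? _; exact: ind_ge0.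
    rewrite !expectD -natr1 mulrDl mul1r => Eunion.
    rewrite -(lerD2r (delta / 2)) -addrA -splitr.
    apply: le_trans (lerD EI EDj) _; apply: le_trans Eunion _.
    by rewrite lerD2l.
  - exact: leq_trans ai1 i1j.
  - move=> i; rewrite inE => /orP[/eqP ->|/Im /andP[mi ii1]]; first by rewrite mj leqnn.
    by rewrite mi (leq_trans ii1).
move=> /(_ r (leqnn r))[I [i1 [_ _ _]]].
by apply/negP; rewrite -ltNge; apply: le_lt_trans rd; exact: expect_ind_le1.
Qed.

(** After [freq_pair], the coordinates from [a] up to [d i0] are chosen by averaging. Since [delta']
    is fixed before [m], the index [i0] can be required to be large in terms of [delta']. *)
Lemma freq_fix a (delta : rat) x : 0 < delta ->
  freq (fun i => delta <= expect (index_iota a (d i)) (fun y => ind (D i y)) x) ->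
  exists2 delta' : rat, 0 < delta' & forall m, exists i0 x',
    [/\ (m <= i0)%N, (a <= d i0)%N,
        forall p, (p < a)%N || (d i0 <= p)%N -> x' p = x p,
        forall p, (a <= p < d i0)%N -> x' p \in K p &
        D i0 x' /\ freq (fun i => delta' <=
      expect (index_iota (d i0) (d i)) (fun y => ind (D i y)) x')].
Proof.
move=> d0 fD; have [delta' d'0 H] := freq_pair d0 fD; exists delta' => // m.
have [i0] := H (maxn m a); rewrite geq_max => /andP[mi0 ai0] fi.
have ad : (a <= d i0)%N := leq_trans ai0 (d_ge _).
have [|x' [x'x x'K fx']] := @freq_expect_point (index_iota a (d i0))
    (fun i => expect (index_iota (d i0) (d i)) (fun y => ind (D i0 y /\ D i y)))
    delta' x.
  apply: (freq_sub (m := i0) fi) => i i0i; rewrite (@index_iota_cat a (d i0)).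
    by rewrite expect_cat.
  by rewrite ad d_homo.
exists i0, x'; split=> //.
- by move=> p pa; apply: x'x; rewrite mem_index_iota negb_and -leqNgt -ltnNge.
- by move=> p pa; apply: x'K; rewrite mem_index_iota.
have Dy i y : (forall p, p \notin index_iota (d i0) (d i) -> y p = x' p) ->
    D i0 y = D i0 x'.
  move=> yx; apply: D_dep => p pi; apply: yx.
  by rewrite mem_index_iota negb_and -ltnNge pi.
split; last first.
  apply: (freq_sub (m := 0) fx') => i _ /le_trans; apply.
  apply: expect_le_at => y _.
  by apply: ind_le => -[].
(* [D i0] does not see the coordinates from [d i0] on, so a positive probability of the joint event
   forces it outright at [x']. *)
have [i _ Ei] := fx' 0%N; apply: contrapT => nD; move: (lt_le_trans d'0 Ei).
apply/negP; rewrite -leNgt -[leRHS](expect_cst (index_iota (d i0) (d i)) 0 x').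
apply: expect_le_at => y yx; rewrite ind0 // => -[Di0 _]; apply: nD.
by rewrite -(Dy i y).
Qed.
End Levels.
End Density.

(** * Colours depending on the lower coordinates only *)

(** The history below [a], coded in a finite type and faithfully so when [w p <= p]. Tables of
    colours indexed by histories then form a finite palette for Ramsey's theorem. *)
Definition trunc (a : nat) (w : npoint) : {ffun 'I_a -> 'I_a.+1} :=
  [ffun i : 'I_a => inord (w i)].

Definition splice (a : nat) (q : {ffun 'I_a -> 'I_a.+1}) (x : npoint) : npoint :=
  fun p => oapp (fun i : 'I_a => q i : nat) (x p) (insub p).

Lemma splice_ge a q x p : a <= p -> splice (a := a) q x p = x p.
Proof. by rewrite /splice leqNgt => pa; rewrite insubN. Qed.

Lemma splice_trunc a w x p : p < a -> w p <= p -> splice (trunc a w) x p = w p.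
Proof.
move=> pa wp; rewrite /splice insubT /= ffunE inordK //= ltnS.
by rewrite (leq_trans wp) // ltnW.
Qed.

Lemma splice_eq a q x y p : x p = y p -> splice (a := a) q x p = splice q y p.
Proof. by rewrite /splice => ->. Qed.

Lemma eq_trunc a w w' : (forall p, p < a -> w p = w' p) -> trunc a w = trunc a w'.
Proof. by move=> ww; apply/ffunP => i; rewrite !ffunE ww. Qed.

Definition in_box (H : nat -> seq nat) (a : nat) (x w : npoint) :=
  (forall p, p < a -> w p \in H p) /\ (forall p, a <= p -> w p = x p).

Local Notation colour a := {ffun {ffun 'I_a -> 'I_a.+1} -> bool}.

Section Canonize.
(** [C n l A x] is the colour at level [n] with the k-set [A] at coordinate [l] and the other
    coordinates taken from [x]. *)
Variables (k : nat) (C : nat -> nat -> seq nat -> npoint -> bool).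
Hypothesis C_dep : forall (n l : nat) A x y,
  (forall p, p <= n -> p != l -> x p = y p) -> C n l A x = C n l A y.

(** The decision made at one coordinate [p]: its set, whether [p] is one of the [l_i], and in that
    case the colour function [v_i]. *)
Record label := Label {
  lset : seq nat;
  lmark : bool;
  lcol : npoint -> bool
}.

Definition canonical_at (G : nat -> label) (a n : nat) (w : npoint) :=
  forall l, l < a -> lmark (G l) -> forall A, subseq A (lset (G l)) ->
    size A = k -> C n l A w = lcol (G l) w.

Definition canonical (G : nat -> label) (a n : nat) (x : npoint) :=
  forall w, in_box (lset \o G) a x w -> canonical_at G a n w.

Definition cdens (a n : nat) (P : npoint -> Prop) (x : npoint) : rat :=
  expect (fun j => iota 0 j.+1) (index_iota a n.+1) (fun y => ind (P y)) x.

(** In a state [(a, l, G)] the coordinates below [a] are committed and [l] is the latest marked one.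
    The base point [fun=> 0] is harmless, as [canonical G a n] looks only at the coordinates from
    [a] to [n]. *)
Definition stage_inv (st : nat * nat * (nat -> label)) : Prop :=
  let: (a, _, G) := st in
  [/\ forall p, p < a -> subseq (lset (G p)) (iota 0 p.+1),
      forall p, p < a -> depends_below p (lcol (G p)) &
      exists2 delta, (0 < delta)%R &
        freq (fun n => delta <= cdens a n (canonical G a n) (fun=> 0))%R].

(** The level selected at this step is [a'.-1]: all its coordinates are committed, so its colours
    are canonical whatever [x] is. *)
Definition stage_step (i : nat) (st st' : nat * nat * (nat -> label)) : Prop :=
  let: (a, _, G) := st in let: (a', l, G') := st' in
  [/\ a <= l < a', forall p, p < a -> G' p = G p,
      lmark (G' l) /\ size (lset (G' l)) = i.+1,
      forall p, a <= p < a' -> p != l -> size (lset (G' p)) = 1 &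
      forall x, canonical G' a' a'.-1 x].

Lemma canonical_dep G a n : (forall p, p < a -> depends_below p (lcol (G p))) ->
  depends_below n.+1 (canonical G a n).
Proof.
move=> Gdep.
have H x y : (forall p, p < n.+1 -> x p = y p) -> canonical G a n x ->
    canonical G a n y.
  move=> xy cx w [wH wy] l la ml A AG Ak.
  pose w' : npoint := fun p => if p < a then w p else x p.
  have w'w p : p <= n -> w' p = w p.
    by rewrite /w' => pn; case: ltnP => // ap; rewrite xy // wy.
  rewrite (@C_dep n l A w w'); last by move=> p pn _; rewrite w'w.
  rewrite (cx w') //; last first.
    split=> p pa; rewrite /w'; first by rewrite pa; exact: wH.
    by rewrite ltnNge pa.
  by apply: (Gdep l la) => p pl; rewrite /w' (ltn_trans pl la).
by move=> x y xy; apply/propext; split; apply: H => // p pn; rewrite xy.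
Qed.

Section Extend.
Variables (a M : nat) (G : nat -> label).
Hypothesis Gsub : forall p, p < a -> subseq (lset (G p)) (iota 0 p.+1).
Hypothesis Gdep : forall p, p < a -> depends_below p (lcol (G p)).

(** Homogeneity for every history [q] at once makes the new colour a function [v] of the history;
    staying in the section of [canonical] keeps the earlier colours for each choice in [T]. *)
Definition extends_at (l : nat) (T : seq nat) (v : colour a) (n : nat)
    (x : npoint) : Prop :=
  [/\ size T = M, forall e, e \in T -> canonical G a n (upd x l e) &
      forall q, homogeneous k (fun A => C n l A (splice q x)) T (v q)].

Lemma extends_at_dep l T v n : depends_below n.+1 (extends_at l T v n).
Proof.
have H x y : (forall p, p < n.+1 -> x p = y p) -> extends_at l T v n x ->
    extends_at l T v n y.
  move=> xy [sT cT hT]; split=> // [e eT|q A AT Ak].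
    rewrite -(@canonical_dep G a n Gdep (upd x l e)); first exact: cT.
    by move=> p pn; rewrite /upd xy.
  rewrite -(hT q A AT Ak); apply: C_dep => p pn _.
  by apply/esym/splice_eq; exact: xy.
by move=> x y xy; apply/propext; split; apply: H => // p pn; rewrite xy.
Qed.

(** Ramsey's theorem is applied to the table of colours of a k-set over all histories. The palette
    depends on [a] alone, so [R] is known before [l]; coding [T] by a mask leaves finitely many
    outcomes, the same for all [n]. *)
Lemma extends_at_exists : exists R, forall l n x,
  R <= count (fun e => `[< canonical G a n (upd x l e) >]) (iota 0 l.+1) ->
  exists u : l.+1.-tuple bool * colour a,
    extends_at l (mask u.1 (iota 0 l.+1)) u.2 n x.
Proof.
have [R HR] := finite_ramsey nat (colour a) k M; exists R => l n x.
rewrite -size_filter => /(HR (fun A => [ffun q => C n l A (splice q x)])).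
move=> [T [v [Tsub sT hT]]].
have /subseqP[m] := subseq_trans Tsub (filter_subseq _ _).
rewrite size_iota => /eqP sm eT; exists (Tuple sm, v) => /=; rewrite -eT.
split=> // [e /(mem_subseq Tsub)|q A AT Ak].
  by rewrite mem_filter => /andP[/asboolP].
by have /ffunP/(_ q) := hT A AT Ak; rewrite ffunE.
Qed.

Definition extension (l : nat) (T : seq nat) (v : colour a) (a' : nat)
    (x' : npoint) (p : nat) : label :=
  if p < a then G p
  else if p == l then Label T true (v \o trunc a)
  else Label [:: x' p] false xpred0.

(** For a mark below [a], [w] lies in the box of [upd y l (w l)] with [w l] in [T]. For the mark
    [l], the history of [w] selects the homogeneous colour, and [C] ignores coordinate [l] of the
    point. *)
Lemma extends_at_canonical l T v a' x' n y w : a <= l < a' ->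
  (forall p, p < a' -> y p = x' p) -> (forall p, a' <= p -> y p = w p) ->
  extends_at l T v n y ->
  (forall p, p < a' -> w p \in lset (extension l T v a' x' p)) ->
  canonical_at (extension l T v a' x') a' n w.
Proof.
move=> /andP[al la'] yx yw [sT cT hT] wG l' l'a'.
have wl : w l \in T by have := wG l la'; rewrite /extension ltnNge al eqxx.
have wa p : p < a -> w p \in lset (G p).
  move=> pa; have := wG p (ltn_trans (leq_trans pa al) la').
  by rewrite /extension pa.
have wy p : a <= p -> p != l -> w p = y p.
  move=> ap pl; have [pa'|] := ltnP p a'; last by move/yw.
  have := wG p pa'; rewrite /extension ltnNge ap (negPf pl) inE => /eqP ->.
  by rewrite yx.
rewrite /extension; case: ltnP => [l'a|al'].
  move=> ml A AG Ak; apply: (cT _ wl w) => //.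
  by split=> // p ap; rewrite /upd; case: eqP => [->//|/eqP]; exact: wy.
case: eqP => [->|//] _ A AT Ak.
rewrite /= -(hT (trunc a w) A AT Ak); apply: C_dep => p pn pl.
have [pa|ap] := ltnP p a; last by rewrite splice_ge // wy.
rewrite splice_trunc //.
by have := mem_subseq (Gsub pa) (wa p pa); rewrite mem_iota.
Qed.
End Extend.


Lemma stage_exists i st : stage_inv st ->
  exists st', stage_inv st' /\ stage_step i st st'.
Proof.
case: st => [[a l0] G] [Gsub Gdep [delta d0 fG]].
have [R HR] := extends_at_exists a i.+1 G.
(* [l] is so large that [R] values are at most a [delta / 2] share of its range. *)
pose l := a + Num.bound (R%:R / (delta / 2))%R.
have al : a <= l by rewrite leq_addr.
have Rl : (R%:R <= (size (iota 0 l.+1))%:R * (delta / 2))%R.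
  rewrite size_iota -ler_pdivrMr ?divr_gt0 // ltW //.
  apply: lt_le_trans (archi_boundP _) _; last by rewrite ler_nat leqW // leq_addl.
  by rewrite divr_ge0 // ltW // divr_gt0.
have K0 j : 0 < size (iota 0 j.+1) by rewrite size_iota.
have [|[m v] /= fE] := @freq_section _ K0 _ (fun n => index_iota a n.+1)
    (fun n => canonical G a n)
    (fun (u : l.+1.-tuple bool * colour a) n x =>
       extends_at i.+1 G l (mask u.1 (iota 0 l.+1)) u.2 n x)
    l R delta (fun=> 0) d0 Rl (HR l).
  apply: (freq_sub (m := l) fG) => n ln dE; split=> //; first exact: iota_uniq.
  by rewrite mem_index_iota al ltnS.
set T := mask m (iota 0 l.+1) in fE.
have Tsub : subseq T (iota 0 l.+1) by exact: mask_subseq.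
have [||||delta' d'0 H] := freq_fix K0 (d := succn)
    (D := fun n x => extends_at i.+1 G l T v n x) _ _ _ _ fE.
- by move=> ? ?; rewrite ltnS.
- by move=> ?; exact: leqnSn.
- by move=> n; exact: extends_at_dep.
- by rewrite !divr_gt0.
(* The coordinates from [a] to [n0] are committed to [x'], except that the value at [l] is discarded
   in favour of [T]. *)
have [n0 [x' [ln0 an0 x'x x'K [En0 fn0]]]] := H l.
have la' : a <= l < n0.+1 by rewrite al ltnS.
exists (n0.+1, l, extension G l T v n0.+1 x'); split; last first.
  split=> //.
  - by move=> p pa; rewrite /extension pa.
  - by rewrite /extension ltnNge al eqxx /=; split=> //; case: En0.
  - by move=> p /andP[ap _] pl; rewrite /extension ltnNge ap (negPf pl).
  - move=> x w [wG _] /=.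
    pose y p := if p < n0.+1 then x' p else w p.
    apply: (@extends_at_canonical a i.+1 G Gsub l T v n0.+1 x' n0 y w la') => //.
    + by move=> p pn; rewrite /y pn.
    + by move=> p pn; rewrite /y ltnNge pn.
    + rewrite (@extends_at_dep a i.+1 G Gdep l T v n0 y x') //.
      by move=> p pn; rewrite /y pn.
split=> [p pn|p pn|].
- rewrite /extension; case: ltnP => [/Gsub //|ap]; case: eqP => [-> //|_].
  suff: x' p \in iota 0 p.+1 by rewrite -sub1seq.
  by apply: x'K; rewrite ap.
- rewrite /extension; case: ltnP => [/Gdep //|ap]; case: eqP => [-> //|/eqP pl] //=.
  move=> x y xy /=; congr (v _); apply: eq_trunc => q qa; apply: xy.
  exact: leq_trans al.
exists delta' => //; apply: (freq_sub (m := 0) fn0) => n _ /le_trans; apply.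
apply: expect_le => // y z yz yx z0; apply: ind_le => Ey w [wG wz].
pose y' p := if p < n0.+1 then x' p else w p.
apply: (@extends_at_canonical a i.+1 G Gsub l T v n0.+1 x' n y' w la') => //.
- by move=> p pn; rewrite /y' pn.
- by move=> p pn; rewrite /y' ltnNge pn.
rewrite (@extends_at_dep a i.+1 G Gdep l T v n y' y) //.
move=> p pn; rewrite /y'; case: ltnP => pn0.
  by rewrite yx // mem_index_iota negb_and -ltnNge pn0.
by rewrite wz // yz // mem_index_iota pn0.
Qed.

Lemma canonical_form : exists (l n : nat -> nat) (H : nat -> seq nat)
    (v : nat -> npoint -> bool),
  [/\ forall i, l i <= n i < l i.+1,
      forall p, subseq (H p) (iota 0 p.+1),
      (forall i, size (H (l i)) = i.+1) /\
        (forall p, (forall i, p != l i) -> size (H p) = 1),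
      forall i, depends_below (l i) (v i) &
      forall i j, j <= i -> forall A w, subseq A (H (l j)) -> size A = k ->
        (forall p, w p \in H p) -> C (n i) (l j) A w = v j w].
Proof.
have K0 j : 0 < size (iota 0 j.+1) by rewrite size_iota.
(* With [a = 0] there is no mark yet, so all events are certain and [delta = 1] works. *)
have Inv0 : stage_inv (0, 0, fun=> Label [::] false xpred0).
  split=> //; exists 1%R => // m; exists m => //.
  rewrite /cdens -[leLHS](expect_cst K0 (index_iota 0 m.+1) _ (fun=> 0)).
  by apply: expect_le_at => // y _; rewrite ind1.
have [f [f0 fS]] := @dependent_choice_seq _ (fun=> stage_inv) stage_step _
  Inv0 (fun i st => @stage_exists i st).
pose a i := (f i).1.1; pose G i := (f i).2.
pose l i := (f i.+1).1.2; pose n i := (a i.+1).-1.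
have Sub i p : p < a i -> subseq (lset (G i p)) (iota 0 p.+1).
  by have [+ _] := fS i; rewrite /a /G; case: (f i) => [[? ?] ?] [H _ _]; exact: H.
have Dep i p : p < a i -> depends_below p (lcol (G i p)).
  by have [+ _] := fS i; rewrite /a /G; case: (f i) => [[? ?] ?] [_ H _]; exact: H.
have St i : [/\ a i <= l i < a i.+1, forall p, p < a i -> G i.+1 p = G i p,
      lmark (G i.+1 (l i)) /\ size (lset (G i.+1 (l i))) = i.+1,
      forall p, a i <= p < a i.+1 -> p != l i -> size (lset (G i.+1 p)) = 1 &
      forall x, canonical (G i.+1) (a i.+1) (n i) x].
  have [_] := fS i; rewrite /stage_step /n /a /l /G.
  by case: (f i) (f i.+1) => [[? ?] ?] [[? ?] ?].
have aS i : a i < a i.+1.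
  by have [/andP[al la] _ _ _ _] := St i; exact: leq_ltn_trans al la.
have GS i p : p < a i -> G i.+1 p = G i p by case: (St i) => _ H _ _ _; exact: H.
have Glim := limit_of_agreeing aS GS.
have a_homo : {homo a : i j / i <= j} 
  by apply: homo_leq (fun i => ltnW (aS i)) => // y x z; exact: leq_trans.
have a_ge i : i <= a i by elim: i => // i Hi; apply: leq_ltn_trans Hi (aS i).
have lP i : a i <= l i < a i.+1 by case: (St i).
have Gl i : G (l i).+1 (l i) = G i.+1 (l i) by apply: Glim; case/andP: (lP i).
exists l, n, (fun p => lset (G p.+1 p)), (fun i => lcol (G (l i).+1 (l i))); split.
- move=> i; have /andP[al la] := lP i; have /andP[al' _] := lP i.+1.
  move: la al'; rewrite /n; case: (a i.+1) => // b; rewrite ltnS /= => -> bl.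
  exact: bl.
- by move=> p; apply: Sub.
- split=> [i|p pl]; first by rewrite Gl; case: (St i) => _ _ [].
  have ex : exists i, p < a i.+1 by exists p; exact: (a_ge p.+1).
  (* At the least stage committing [p], [p] lies between [a i] and [a i.+1], where all sets but the
     one at [l i] are singletons. *)
  case: (ex_minnP ex) => i pi mini; rewrite (Glim i.+1 p pi).
  have [_ _ _ H _] := St i; apply: H => //; rewrite pi andbT.
  case: i pi mini => [|i] pi mini; first by rewrite /a f0.
  by rewrite leqNgt; apply/negP => /mini; rewrite ltnn.
- by move=> i; apply: Dep.
move=> i j ji A w AH Ak wH; have [_ _ _ _ /(_ w w)] := St i.
have lj : l j < a i.+1.
  by have /andP[_ la] := lP j; apply: leq_trans la (a_homo _ _ _).
have Glj : G i.+1 (l j) = G (l j).+1 (l j) by rewrite (Glim i.+1 _ lj).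
move=> can; rewrite -Glj; apply: can => //.
- by split=> // p pa /=; rewrite -(Glim i.+1 p pa).
- by rewrite Glj Gl; case: (St j) => _ _ [].
- by rewrite Glj.
Qed.
End Canonize.

(** * Stabilizing the colours *)

Section Stabilize.
(** [K] is to be the family from the first round. Its sets are known to be large only at the
    coordinates [l i], so sections are taken there. *)
Variables (K : nat -> seq nat) (l : nat -> nat) (v : nat -> npoint -> bool).
Variable m : nat -> nat.
Hypothesis K0 : forall p, 0 < size (K p).
Hypothesis l_incr : forall i, l i < l i.+1.
Hypothesis K_large : forall i, i < size (K (l i)).
Hypothesis v_dep : forall i, depends_below (l i) (v i).

Let l_lt : {homo l : i j / i < j}.
Proof. by apply: homo_ltn l_incr => y x z; exact: ltn_trans. Qed.

Let l_le : {homo l : i j / i <= j}.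
Proof.
by apply: homo_leq (fun i => ltnW (l_incr i)) => // y x z; exact: leq_trans.
Qed.

Let l_ge i : i <= l i.
Proof. by elim: i => // i Hi; apply: leq_ltn_trans Hi (l_incr i). Qed.

Section Colour.
Variable b : bool.

Definition constant_at (H : nat -> seq nat) (a i : nat) (x : npoint) :=
  forall w, in_box H a x w -> v i w = b.

Lemma constant_at_dep H a i : depends_below (l i) (constant_at H a i).
Proof.
have imp x y : (forall p, p < l i -> x p = y p) -> constant_at H a i x ->
    constant_at H a i y.
  move=> xy cx w [wH wy].
  pose w' : npoint := fun p => if p < a then w p else x p.
  rewrite -(cx w'); last first.
    split=> p pa; rewrite /w'; first by rewrite pa; exact: wH.
    by rewrite ltnNge pa.
  by apply: v_dep => p pl; rewrite /w'; case: ltnP => // ap; rewrite wy // xy.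
by move=> x y xy; apply/propext; split; apply: imp => // p pl; rewrite xy.
Qed.

Definition fusion_inv (st : nat * nat * (nat -> seq nat)) : Prop :=
  let: (a, _, H) := st in
  (forall p, p < a -> subseq (H p) (K p)) /\
  exists2 delta : rat, (0 < delta)%R &
    freq (fun i => delta <= expect K (index_iota a (l i))
                     (fun y => ind (constant_at H a i y)) (fun=> 0%N))%R.

Definition fusion_step (s : nat) (st st' : nat * nat * (nat -> seq nat)) : Prop :=
  let: (a, _, H) := st in let: (a', j, H') := st' in
  [/\ a <= l j /\ a' = (l j).+1, forall p, p < a -> H' p = H p,
      size (H' (l j)) = m s, forall p, a <= p < l j -> size (H' p) = 1 &
      forall x, constant_at H' a' j x].

(** The two operations come in the opposite order to the first round: [freq_fix] commits the
    coordinates below [l j], which decide [v j], and then a section at [l j], which [v j] does not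
    see, preserves the later colours. *)
Lemma fusion_exists s st : fusion_inv st ->
  exists st', fusion_inv st' /\ fusion_step s st st'.
Proof.
case: st => [[a j0] H] [HK [delta d0 fH]].
have [delta' d'0 fix_] := freq_fix K0 l_le l_ge (constant_at_dep H a) d0 fH.
(* [j] is large in terms of [delta'], so that [m s] elements are at most a [delta' / 2] share of
   [K (l j)], whose size exceeds [j]. *)
have [j [x' [jb alj x'0 x'K [cj fj]]]] :=
  fix_ (Num.bound ((m s)%:R / (delta' / 2)))%R.
have Ml : ((m s)%:R <= (size (K (l j)))%:R * (delta' / 2))%R.
  rewrite -ler_pdivrMr ?divr_gt0 // ltW //.
  apply: lt_le_trans (archi_boundP _) _.
    by rewrite divr_ge0 // ltW // divr_gt0.
  by rewrite ler_nat (leq_trans jb) // ltnW.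
pose F (T : seq nat) i x := size T = m s /\
  forall e, e \in T -> constant_at H a i (upd x (l j) e).
have [||u fu] := @freq_section K K0 ((size (K (l j))).-tuple bool)
    (fun i => index_iota (l j) (l i)) (constant_at H a)
    (fun u i x => F (mask u (K (l j))) i x) (l j) (m s) delta' x' d'0 Ml.
- move=> i y; rewrite -size_filter; set S := filter _ _ => mS.
  have /subseqP[u su eS] : subseq (take (m s) S) (K (l j)).
    exact: subseq_trans (take_subseq _ _) (filter_subseq _ _).
  exists (Tuple (introT eqP su)); rewrite /= -eS; split; first by rewrite size_takel.
  by move=> e /mem_take; rewrite mem_filter => /andP[/asboolP].
- apply: (freq_sub (m := j.+1) fj) => i ji Ei; split=> //; first exact: iota_uniq.
  by rewrite mem_index_iota leqnn /= l_lt.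
set T := mask u _ in fu; set delta'' := (_ / _)%R in fu.
have d''0 : (0 < delta'')%R by rewrite !divr_gt0.
(* [F T i] overwrites coordinate [l j], so giving it a value here only removes it from the
   expectation. *)
have [|x'' [x''0 _ fx'']] := @freq_expect_point K K0 (index_iota (l j) (l j).+1)
    (fun i => expect K (index_iota (l j).+1 (l i)) (fun y => ind (F T i y)))
    delta'' x'.
  apply: (freq_sub (m := j.+1) fu) => i ji; rewrite -expect_cat.
  by rewrite -index_iota_cat // leqnSn l_lt.
have sT : size T = m s.
  have [i _ dE] := fx'' 0; apply: contrapT => nT; move: (lt_le_trans d''0 dE).
  apply/negP; rewrite -leNgt.
  rewrite -[leRHS](expect_cst K0 (index_iota (l j).+1 (l i)) 0%R x'').
  by apply: expect_le_at => // y _; rewrite ind0 // => -[].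
pose H' p := if p < a then H p else if p == l j then T else [:: x' p].
have H'l : H' (l j) = T by rewrite /H' ltnNge alj eqxx.
exists ((l j).+1, j, H'); split; last first.
  split=> //.
  - by move=> p pa; rewrite /H' pa.
  - by rewrite H'l.
  - by move=> p /andP[ap pl]; rewrite /H' ltnNge ap /= ltn_eqF.
  - move=> x w [wH _]; pose w' p := if p < l j then w p else x' p.
    rewrite (@v_dep j w w'); last by move=> p pl; rewrite /w' pl.
    apply: cj; split=> p pa.
      have pl := leq_trans pa alj.
      by have := wH p (ltnW pl); rewrite /H' pa /w' pl.
    rewrite /w'; case: ltnP => // pl; have := wH p (ltnW pl).
    by rewrite /H' ltnNge pa /= ltn_eqF // inE => /eqP.
split=> [p pl|].
  rewrite /H'; case: ltnP => [/HK//|ap]; case: eqP => [->|/eqP pnl].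
    exact: mask_subseq.
  suff: x' p \in K p by rewrite -sub1seq.
  by apply: x'K; rewrite ap ltn_neqAle pnl -ltnS.
exists delta'' => //; apply: (freq_sub (m := j.+1) fx'') => i ji /le_trans; apply.
have lji := l_lt ji.
apply: expect_le => // y z yz yx _; apply: ind_le => -[_ FT] w [wH wz].
have wl : w (l j) \in T by have := wH (l j) (ltnSn _); rewrite H'l.
pose w' p := if p < l i then w p else y p.
rewrite (@v_dep i w w'); last by move=> p pl; rewrite /w' pl.
apply: (FT _ wl); split=> p pa.
  have pl := leq_trans pa alj.
  by have := wH p (ltnW pl); rewrite /H' pa /w' (ltn_trans pl lji).
rewrite /w' /upd; case: eqP => [->|/eqP pnl]; first by rewrite lji.
case: ltnP => // pli; have [pl|lp|/eqP] := ltngtP p (l j); last by rewrite (negPf pnl).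
  have := wH p (ltnW pl); rewrite /H' ltnNge pa /= (negPf pnl) inE => /eqP ->.
  rewrite yx; last by rewrite mem_index_iota negb_and -ltnNge ltnW.
  by rewrite x''0 // mem_index_iota negb_and -ltnNge pl.
by rewrite wz // yz // mem_index_iota lp.
Qed.
End Colour.

(** For each [i] the probabilities of the two colours add up to 1, so one of them is at least 1/2;
    one colour recurs infinitely often. *)
Lemma freq_colour : exists b, fusion_inv b (0, 0, fun=> [::]).
Proof.
have half i : exists b, (1 / 2 <= expect K (index_iota 0 (l i))
    (fun y => ind (v i y = b)) (fun=> 0%N))%R.
  apply: contrapT => /forallNP nb.
  have := expect_cst K0 (index_iota 0 (l i)) 1%R (fun=> 0%N).
  have -> : (fun=> 1%R) = (fun y => ind (v i y = true) + ind (v i y = false))%R.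
    apply/funext => y; case: (v i y).
      by rewrite (ind1 (erefl true)) ind0 // addr0.
    by rewrite (ind1 (erefl false)) ind0 // add0r.
  rewrite expectD; apply/eqP; rewrite lt_eqF //.
  have lt b : (expect K (index_iota 0 (l i))
    (fun y => ind (v i y = b)) (fun=> 0%N) < 1 / 2)%R.
    by rewrite ltNge; apply/negP; exact: nb.
  by apply: lt_le_trans (ltrD (lt true) (lt false)) _; rewrite -splitr.
have [|b _ fb] := @freq_pigeonhole _ [:: true; false] (fun b i =>
  (1 / 2 <= expect K (index_iota 0 (l i)) (fun y => ind (v i y = b)) (fun=> 0%N))%R).
  move=> i; exists i => //; have [b Hb] := half i; exists b => //.
  by case: b {Hb}.
exists b; split=> //; exists (1 / 2)%R => //; apply: (freq_sub (m := 0) fb).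
move=> i _ /le_trans; apply; apply: expect_le_at => // y _; apply: ind_le.
move=> vy w [_ wy].
by rewrite -vy; congr (v i _); apply/funext => p; exact: wy.
Qed.

Lemma stable_subproduct : exists (b : bool) (j : nat -> nat) (H : nat -> seq nat),
  [/\ forall s, j s < j s.+1, forall p, subseq (H p) (K p),
      forall s, size (H (l (j s))) = m s,
      forall p, (forall s, p != l (j s)) -> size (H p) = 1 &
      forall s w, (forall p, w p \in H p) -> v (j s) w = b].
Proof.
have [b Inv0] := freq_colour.
have [f [f0 fS]] := @dependent_choice_seq _ (fun=> fusion_inv b) (fusion_step b) _
  Inv0 (fun s st => @fusion_exists b s st).
pose a s := (f s).1.1; pose H s := (f s).2; pose j s := (f s.+1).1.2.
have Sub s p : p < a s -> subseq (H s p) (K p).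
  by have [+ _] := fS s; rewrite /a /H; case: (f s) => [[? ?] ?] [h _]; exact: h.
have St s : [/\ a s <= l (j s) /\ a s.+1 = (l (j s)).+1,
      forall p, p < a s -> H s.+1 p = H s p,
      size (H s.+1 (l (j s))) = m s,
      forall p, a s <= p < l (j s) -> size (H s.+1 p) = 1 &
      forall x, constant_at b (H s.+1) (a s.+1) (j s) x].
  have [_] := fS s; rewrite /fusion_step /a /H /j.
  by case: (f s) (f s.+1) => [[? ?] ?] [[? ?] ?].
have al s : a s <= l (j s) by case: (St s) => -[].
have aE s : a s.+1 = (l (j s)).+1 by case: (St s) => -[].
have aS s : a s < a s.+1 by rewrite aE ltnS.
have HS s p : p < a s -> H s.+1 p = H s p by case: (St s) => _ h _ _ _; exact: h.
have Hlim := limit_of_agreeing aS HS.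
have a_ge s : s <= a s by elim: s => // s Hs; apply: leq_ltn_trans Hs (aS s).
exists b, j, (fun p => H p.+1 p); split.
- move=> s; rewrite ltnNge; apply/negP => /l_le; apply/negP; rewrite -ltnNge.
  by have := al s.+1; rewrite aE.
- by move=> p; apply: Sub.
- by move=> s; rewrite (Hlim s.+1) ?aE //; case: (St s).
- move=> p pl; have ex : exists s, p < a s.+1 by exists p; exact: (a_ge p.+1).
  case: (ex_minnP ex) => s ps mins; rewrite (Hlim s.+1 p ps).
  have [_ _ _ h _] := St s; apply: h.
  rewrite andbC ltn_neqAle pl -ltnS -aE ps /=.
  case: s ps mins => [|s] ps mins; first by rewrite /a f0.
  by rewrite leqNgt; apply/negP => /mins; rewrite ltnn.
move=> s w wH; have [_ _ _ _ /(_ w w)] := St s; apply; split=> // p pa.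
by rewrite -(Hlim s.+1 p pa).
Qed.
End Stabilize.

(** * Transfer to the sets K_j *)

Lemma card_uniq_seq (s : seq nat) : uniq s -> [set` s] #= `I_(size s).
Proof.
move=> us; have -> : [set` s] = nth 0 s @` `I_(size s).
  apply/seteqP; split=> e /=.
    by move=> es; exists (index e s); rewrite /= ?index_mem ?nth_index.
  by move=> [i /= si <-]; rewrite mem_nth.
apply: inj_card_eq => i i'; rewrite !inE /= => si si' /eqP.
by rewrite nth_uniq // => /eqP.
Qed.

Lemma card_injection (T : Type) d : `I_d.+1 #<= [set: T] ->
  exists f : nat -> T, {in `I_d.+1 &, injective f}.
Proof.
move=> /pcard_surjP[g gsurj].
have /choice[f fP] : forall e, exists y, e < d.+1 -> g y = e.
  move=> e; have [/gsurj[y _ gy]|de] := ltnP e d.+1; first by exists y.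
  by have [y _ _] := gsurj 0 (ltn0Sn d); exists y.
by exists f => e e'; rewrite !inE /= => /fP ge /fP ge' ee'; rewrite -ge -ge' ee'.
Qed.

Section Transfer.
Variables (k : nat) (K : nat -> Type) (c : prod_point k K -> 'I_2).
Variable f : forall j, nat -> K j.
Hypothesis f_inj : forall j, {in `I_j.+1 &, injective (@f j)}.

Definition represents (n l : nat) (A : seq nat) (x : npoint) (p : prod_point k K) :=
  [/\ pt_n p = n, pt_l p = l :> nat, pt_set p = @f (pt_l p) @` [set` A] &
     forall (j : 'I_(pt_n p).+1) (jl : j != pt_l p), pt_tuple p j jl = @f j (x j)].

Lemma represents_uniq n l A x p q :
  represents n l A x p -> represents n l A x q -> p = q.
Proof.
case: p => n1 l1 S1 P1 t1 [/= <-{n} <-{l} ES1 Et1].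
case: q => n2 l2 S2 P2 t2 [/= en el ES2 Et2].
subst n2; have {}el := val_inj el; subst l2.
subst S1 S2; have -> : t1 = t2.
  by apply: functional_extensionality_dep => j; apply/funext => jl; rewrite Et1 Et2.
by rewrite (Prop_irrelevance P1 P2).
Qed.

(** At most one point represents the data, and none does if [l > n] or the image of [A] does not
    have [k] elements; the value is then [false]. *)
Definition seq_colour (n l : nat) (A : seq nat) (x : npoint) : bool :=
  `[< exists2 p, represents n l A x p & c p = ord0 >].

Lemma seq_colour_dep (n l : nat) A x y :
  (forall p, p <= n -> p != l -> x p = y p) ->
  seq_colour n l A x = seq_colour n l A y.
Proof.
have imp u w : (forall p, p <= n -> p != l -> u p = w p) ->
    seq_colour n l A u -> seq_colour n l A w.
  move=> uw /asboolP[p [pn pl pS pt] cp]; apply/asboolP; exists p => //.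
  split=> // j jl; rewrite pt uw //; first by rewrite -ltnS -pn.
  by rewrite -pl.
by move=> xy; apply/idP/idP; apply: imp => // p pn pl; rewrite xy.
Qed.

Lemma seq_colourE n l A x p : represents n l A x p ->
  seq_colour n l A x = (c p == ord0).
Proof.
move=> rp; apply/asboolP/eqP => [[q rq <-]|]; last by exists p.
by rewrite (represents_uniq rp rq).
Qed.

Lemma box_represents (H : nat -> seq nat) n l p :
  (forall j, subseq (H j) (iota 0 j.+1)) -> (forall j, 0 < size (H j)) ->
  box (fun j => @f j @` [set` H j]) n l p ->
  exists A x, [/\ subseq A (H l), size A = k, forall j, x j \in H j &
                  represents n l A x p].
Proof.
move=> Hsub H0 [pn pl [pS pk] pt].
have HI j e : e \in H j -> `I_j.+1 e.
  by move=> /(mem_subseq (Hsub j)); rewrite mem_iota.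
(* Beyond level [n] and at coordinate [l] the point prescribes nothing, and the head of [H j] serves
   as default. *)
have /choice[x xP] : forall j, exists e, e \in H j /\
    forall (jn : j < (pt_n p).+1) (jl : Ordinal jn != pt_l p),
      pt_tuple p (Ordinal jn) jl = @f j e.
  move=> j; have hd : nth 0 (H j) 0 \in H j by rewrite mem_nth.
  have [jn|jn] := EM (j < (pt_n p).+1); last first.
    by exists (nth 0 (H j) 0); split=> // jn'.
  have [jl|jl] := EM (Ordinal jn != pt_l p); last first.
    by exists (nth 0 (H j) 0); split=> // jn' jl'; case: jl.
  have [e eH fe] := pt (Ordinal jn) jl; exists e; split=> // jn' jl'.
  move: jl'; rewrite (bool_irrelevance jn' jn) => jl'.
  by rewrite (bool_irrelevance jl' jl) -fe.
pose A := [seq e <- H l | `[< pt_set p (@f (pt_l p) e) >]].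
have AH : subseq A (H l) by exact: filter_subseq.
have pA : pt_set p = @f (pt_l p) @` [set` A].
  apply/seteqP; split=> y.
    move=> py; have [e eH fe] := pS y py; exists e => //=.
    by rewrite mem_filter -pl eH andbT; apply/asboolP; rewrite fe.
  by move=> [e /=]; rewrite mem_filter => /andP[/asboolP pe _] <-.
exists A, x; split=> //.
(* [f] is injective on an initial segment containing [A], so [A] has as many elements as its image,
   the k-set of [p]. *)
- apply/card_eq_II.
  have uA : uniq A by rewrite filter_uniq // (subseq_uniq (Hsub l)) ?iota_uniq.
  apply: card_eq_trans pk; rewrite card_eq_sym pA.
  apply: card_eq_trans (card_uniq_seq uA); apply: inj_card_eq.
  have AI e : e \in [set` A] -> e \in `I_(pt_l p).+1.
    by rewrite !inE /= => /(mem_subseq AH); rewrite pl; exact: HI.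
  by move=> e e' /AI eI /AI e'I; exact: f_inj.
- by move=> j; case: (xP j).
- split=> // -[j jn] jl; exact: (xP j).2.
Qed.
End Transfer.

Lemma increasing_infinite_range (a : nat -> nat) :
  (forall i, a i < a i.+1) ->
  infinite_set (range a) /\ increasing_enum (range a) a.
Proof.
move=> aS; have a_lt : {homo a : i j / i < j}.
  by apply: homo_ltn aS => y x z; exact: ltn_trans.
split=> //; have /eq_finite_set fin : range a #= [set: nat]; last first.
  by rewrite fin; exact: infinite_nat.
by apply: inj_card_eq => i j _ _ aij; have [/a_lt|/a_lt|//] := ltngtP i j;
  rewrite aij ltnn.
Qed.

Theorem theorem3 (k : nat) (hk : (1 <= k)%N)
    (m : nat -> nat) (hm : forall i, (0 < m i)%N)
    (K : nat -> Type) (hK : forall j, `I_j.+1 #<= [set: K j])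
    (c : prod_point k K -> 'I_2) :
  exists (L N : set nat) (l n : nat -> nat) (H : forall j, set (K j)),
    [/\ infinite_set L /\ infinite_set N,
        increasing_enum L l /\ increasing_enum N n,
        forall i, (l i <= n i)%N && (n i < l i.+1)%N,
        (forall i, H (l i) #= `I_(m i)) /\ (forall j, ~ L j -> H j #= `I_1) &
        constant_on c
          (\bigcup_(a in N) \bigcup_(b in L `&` `I_a.+1) box H a b)].
Proof.
pose f j := projT1 (cid (card_injection (hK j))).
have f_inj j : {in `I_j.+1 &, injective (@f j)}.
  exact: projT2 (cid (card_injection (hK j))).
have [l [n [G [v [ln Gsub [Gl G1] vdep colv]]]]] :=
  canonical_form k (@seq_colour_dep k K c f).
have l_incr i : l i < l i.+1 by have /andP[le lt] := ln i; exact: leq_ltn_trans le lt.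
have G0 p : 0 < size (G p).
  have [[i ->]|/forallNP pl] := EM (exists i, p = l i); first by rewrite Gl.
  by rewrite G1 // => i; apply/eqP/pl.
have [b [j [H [j_incr HG Hm H1 vb]]]] :=
  stable_subproduct m G0 l_incr (fun i => eq_leq (esym (Gl i))) vdep.
have Hsub p : subseq (H p) (iota 0 p.+1) := subseq_trans (HG p) (Gsub p).
have l_lt : {homo l : i i' / i < i'}.
  by apply: homo_ltn l_incr => y x z; exact: ltn_trans.
have l_le : {homo l : i i' / i <= i'}.
  by apply: homo_leq (fun i => ltnW (l_incr i)) => // y x z; exact: leq_trans.
have lj s : l (j s) < l (j s.+1) by exact: l_lt.
have ljn s : l (j s) <= n (j s) < l (j s.+1).
  have /andP[-> lt] := ln (j s); apply: leq_trans lt _; exact: l_le.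
have nj s : n (j s) < n (j s.+1).
  have /andP[_ lt] := ljn s; have /andP[le _] := ljn s.+1.
  exact: leq_trans lt le.
have [infL enumL] := increasing_infinite_range lj.
have [infN enumN] := increasing_infinite_range nj.
have Hcard p : f p @` [set` H p] #= `I_(size (H p)).
  apply: card_eq_trans (card_uniq_seq _); last first.
    exact: subseq_uniq (Hsub p) (iota_uniq _ _).
  have HI e : e \in [set` H p] -> e \in `I_p.+1.
    by rewrite !inE /= => /(mem_subseq (Hsub p)); rewrite mem_iota.
  by apply: inj_card_eq => e e' /HI eI /HI e'I; exact: f_inj.
exists (range (l \o j)), (range (n \o j)), (l \o j), (n \o j),
  (fun p => f p @` [set` H p]); split=> //.
- split=> [s|p pl]; first by rewrite -(Hm s); exact: Hcard.
  rewrite -(H1 p); first exact: Hcard.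
  by move=> s; apply/eqP => ps; apply: pl; exists s.
(* [seq_colour] is true exactly for the colour [ord0]. *)
exists (if b then ord0 else ord_max).
have H0 q : 0 < size (H q).
  have [[i ->]|/forallNP ql] := EM (exists i, q = l (j i)); first by rewrite Hm.
  by rewrite H1 // => i; apply/eqP/ql.
move=> p [_ [s _ <-] [_ [[t _ <-] /= tn]]].
move=> /(box_represents f_inj Hsub H0)[A [x [AH Ak xH rep]]].
(* A marked coordinate of index above [j s] would lie beyond level [n (j s)]; hence the canonical
   form of the first round applies. *)
have jts : j t <= j s.
  rewrite leqNgt; apply/negP => jst; have /andP[_ lt] := ln (j s).
  by have := leq_trans (leq_trans lt (l_le _ _ jst)) tn; rewrite ltnn.
have := colv (j s) (j t) jts A x (subseq_trans AH (HG _)) Ak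
  (fun p => mem_subseq (HG p) (xH p)).
rewrite (seq_colourE c rep) (vb t x xH).
case: b {vb} => [/eqP //|]; case: (c p) => [[|[|]]] // i _.
exact: val_inj.
Qed.
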